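(* Let $(V^k)_k$ be a sequence of point cloud $d$-varifolds in $\mathbb{R}^n$, with $V^0=V$ a given point cloud $d$-varifold, solving the scheme (explicit in positions) with $\Pi=2\,\mathrm{Id}$ and time step $\tau>0$; denote by $x_1^k,\dots,x_N^k$ the positions of the points of $V^k$. Let $z\in\mathbb{R}^n$ and fix $k$. (i) If $p\in\{1,\dots,N\}$ satisfies $|x_p^k-z|=\min_{1\le i\le N}|x_i^k-z|$, then $$|x_p^k-z|^2\le|x_p^{k+1}-z|^2+2d\tau.$$ (ii) Moreover, if $\tau$ is chosen small enough that there exists $p\in\{1,\dots,N\}$ with both $$|x_p^k-z|=\min_{1\le i\le N}|x_i^k-z|\quad\text{and}\quad|x_p^{k+1}-z|=\min_{1\le i\le N}|x_i^{k+1}-z|,$$ then, for all $(a,R)\in\mathbb{R}^n\times\mathbb{R}^+$ (with $R^2\ge 2d\tau$, so that the square root is defined), $$\operatorname{spt}\|V^k\|\subset B(a,R)^c\ \Longrightarrow\ \operatorname{spt}\|V^{k+1}\|\subset B\big(a,\sqrt{R^2-2d\tau}\,\big)^c.$$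
   Context: Here $B(a,r)$ is the ball of center $a$ and radius $r$ in $\mathbb{R}^n$ and $B(a,r)^c$ its complement. The functions $\rho,\xi:\mathbb{R}^+\to\mathbb{R}$ are non-negative, smooth, supported in $[0,1]$, and form a natural kernel pair: $-s\rho'(s)=n\,\xi(s)$ for all $s\in\mathbb{R}^+$. Fix $\varepsilon\in(0,1)$. A point cloud $d$-varifold is $\sum_{i=1}^N m_i\delta_{(x_i,P_i)}$ with $x_i\in\mathbb{R}^n$, masses $m_i>0$ and $d$-planes $P_i$; the support $\operatorname{spt}\|\cdot\|$ of its mass measure is $\{x_1,\dots,x_N\}$. Write $V^k=\sum_{i=1}^N m_i^k\delta_{(x_i^k,P_i^k)}$. The scheme explicit in positions with $\Pi=2\,\mathrm{Id}$ is $$x_i^{k+1}=x_i^k+\frac\tau\varepsilon\sum_{j=1}^N\omega_{ij}^k\,2\,(x_j^k-x_i^k),\qquad i=1,\dots,N,$$ where $\omega_{ii}^k=0$ and, for $i\ne j$, $$\omega_{ij}^k=-\frac dn\,\frac{m_j\,\rho'\!\left(\frac{|x_j^k-x_i^k|}{\varepsilon}\right)\frac1{|x_j^k-x_i^k|}}{\sum_{l=1}^N m_l\,\xi\!\left(\frac{|x_l^k-x_i^k|}{\varepsilon}\right)},$$ with either $m_j=m_j^k$ for all $j$ (explicit masses) or $m_j=m_j^{k+1}$ for all $j$ (implicit masses). Denominators are assumed positive, and the term with index $j$ is understood as $0$ if $x_j^k=x_i^k$. The rules defining the masses and planes along the evolution are arbitrary.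
   Formalization: In (ii) the common nearest index p is required with respect to the centre a of the ball (z = a), for each (a,R) considered; with a single fixed z unrelated to a, the implication for all (a,R) is false. *)

(* Defs.v *)
From HB Require Import structures.
From mathcomp Require Import all_boot all_order all_algebra.
From mathcomp Require Import all_classical all_reals all_analysis.

Set Implicit Arguments.
Unset Strict Implicit.
Unset Printing Implicit Defensive.

Import Order.TTheory GRing.Theory Num.Theory.
Import numFieldNormedType.Exports.

Local Open Scope classical_set_scope.
Local Open Scope ring_scope.

(* The norm MathComp-Analysis puts on 'rV[R]_n is the sup norm, so the
   Euclidean norm and its balls are defined separately. *)
Definition enorm (R : realType) (n : nat) (v : 'rV[R]_n) : R :=
  Num.sqrt (\sum_(i < n) v 0 i ^+ 2).

Definition eball (R : realType) (n : nat) (a : 'rV[R]_n) (r : R) :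
  set 'rV[R]_n := [set y | enorm (y - a) < r].

(* Functions on R+ = [0, +oo[ are represented by functions on R of which only
   the values on [0, +oo[ matter. Smoothness up to the endpoint 0: all
   derivatives exist on ]0, +oo[ and have a limit at 0+, and f is continuous
   at 0+. *)
Definition smooth_Rplus (R : realType) (f : R -> R) : Prop :=
  f x @[x --> 0^'+] --> f 0 /\
  forall k : nat,
    (forall x : R, 0 < x -> derivable (derive1n k f) x 1) /\
    cvg (derive1n k f x @[x --> 0^'+]).

Definition support_Rplus (R : realType) (f : R -> R) : set R :=
  closure [set s : R | 0 <= s /\ f s != 0].

(* At s = 0 the value of derive1 rho, which involves rho outside R+, is
   multiplied by 0. *)
Record natural_kernel_pair (R : realType) (n : nat) (rho xi : R -> R) : Prop :=
  NaturalKernelPair {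
    rho_ge0 : forall s : R, 0 <= s -> 0 <= rho s;
    xi_ge0 : forall s : R, 0 <= s -> 0 <= xi s;
    rho_smooth : smooth_Rplus rho;
    xi_smooth : smooth_Rplus xi;
    rho_support : support_Rplus rho `<=` `[0, 1];
    xi_support : support_Rplus xi `<=` `[0, 1];
    rho_xi : forall s : R, 0 <= s -> - (s * derive1 rho s) = n%:R * xi s
  }.

Record point_cloud (R : realType) (n d N : nat) := PointCloud {
  pos : 'I_N -> 'rV[R]_n;
  mass : 'I_N -> R;
  plane : 'I_N -> {vspace 'rV[R]_n};
  mass_gt0 : forall i, 0 < mass i;
  plane_dim : forall i, (\dim (plane i) = d)%N
}.

(* \sum_i m_i \delta_(x_i, P_i), as a function on all subsets. *)
Definition varifold (R : realType) (n d N : nat) (V : point_cloud R n d N)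
    (B : set ('rV[R]_n * {vspace 'rV[R]_n})) : R :=
  \sum_(i < N) mass V i * \1_B (pos V i, plane V i).

Definition mass_measure (R : realType) (n d N : nat)
    (V : point_cloud R n d N) (A : set 'rV[R]_n) : R :=
  varifold V (A `*` setT).

Definition spt (R : realType) (n : nat) (mu : set 'rV[R]_n -> R) :
  set 'rV[R]_n := [set x | forall r : R, 0 < r -> 0 < mu (eball x r)].

Inductive mass_rule := ExplicitMasses | ImplicitMasses.

Definition scheme_mass (R : realType) (n d N : nat) (mr : mass_rule)
    (V V' : point_cloud R n d N) : 'I_N -> R :=
  match mr with
  | ExplicitMasses => mass V
  | ImplicitMasses => mass V'
  end.

Definition omega_den (R : realType) (n N : nat) (xi : R -> R) (eps : R)
    (m : 'I_N -> R) (x : 'I_N -> 'rV[R]_n) (i : 'I_N) : R :=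
  \sum_(l < N) m l * xi (enorm (x l - x i) / eps).

(* The test x j == x i covers j = i as well as coinciding points. *)
Definition omega (R : realType) (n d N : nat) (rho xi : R -> R) (eps : R)
    (m : 'I_N -> R) (x : 'I_N -> 'rV[R]_n) (i j : 'I_N) : R :=
  if x j == x i then 0 else
  - (d%:R / n%:R) *
    ((m j * derive1 rho (enorm (x j - x i) / eps) * (enorm (x j - x i))^-1) /
     omega_den xi eps m x i).

Definition scheme_step (R : realType) (n d N : nat) (rho xi : R -> R)
    (eps tau : R) (mr : mass_rule) (V V' : point_cloud R n d N) : Prop :=
  let m := scheme_mass mr V V' in
  forall i : 'I_N,
    0 < omega_den xi eps m (pos V) i /\
    pos V' i = pos V i + (tau / eps) *:
      \sum_(j < N) omega d rho xi eps m (pos V) i j *: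
        (2 *: (pos V j - pos V i)).

Definition nearest (R : realType) (n d N : nat) (V : point_cloud R n d N)
    (z : 'rV[R]_n) (p : 'I_N) : Prop :=
  forall i : 'I_N, enorm (pos V p - z) <= enorm (pos V i - z).

(* Main.v *)
Require Import Defs.
From HB Require Import structures.
From mathcomp Require Import all_boot all_order all_algebra.
From mathcomp Require Import all_classical all_reals all_analysis.
From mathcomp Require Import ring lra.
Import Order.TTheory GRing.Theory Num.Theory.
Import numFieldNormedType.Exports.
Local Open Scope classical_set_scope.
Local Open Scope ring_scope.

(** A point [x p] of the cloud that is closest to [z] is moved by a combination
of the differences [x j - x p] with nonnegative weights [c j]. Since
[|x j - z| >= |x p - z|], expanding the square around [x p] gives
[2 (x p - z) . (x j - x p) >= - |x j - x p|^2]: no difference points towards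
[z] by more than a second order amount. Hence one step decreases the squared
distance of [x p] to [z] by at most [\sum_j c j * |x j - x p|^2]
([nearest_displacement]).

For the weights of the scheme this sum is controlled by the kernel identity. With
[s = |x j - x p| / eps], the summand [omega p j * |x j - x p|^2] equals
[eps * d/n * m j * (- s * rho' s)] divided by the normalisation, and the
natural pair identity [- s * rho' s = n * xi s] turns it into
[eps * d * m j * xi s] over [\sum_l m l * xi s_l], so that the sum over [j] is
at most [eps * d] ([omega_second_moment]). The factor [2 * tau / eps] in front
of the displacement then produces the bound [2 * d * tau].

For the inclusion of supports, the support of the mass measure of a point cloud
is its set of positions ([spt_pos], [pos_spt]), so a point of the new cloud in
the ball of squared radius [r^2 - 2 * d * tau] would force the common nearest
point [p] to be in that ball after the step and therefore in the ball of
radius [r] before it. *)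

(** * Euclidean geometry of row vectors *)

Definition edot {R : realType} {n : nat} (u v : 'rV[R]_n) : R :=
  \sum_(i < n) u 0 i * v 0 i.

Lemma enorm_sqr (R : realType) (n : nat) (u : 'rV[R]_n) :
  enorm u ^+ 2 = \sum_(i < n) u 0 i ^+ 2.
Proof. by rewrite sqr_sqrtr // sumr_ge0 // => i _; exact: sqr_ge0. Qed.

Lemma enorm_ge0 (R : realType) (n : nat) (u : 'rV[R]_n) : 0 <= enorm u.
Proof. exact: sqrtr_ge0. Qed.

Lemma enorm0 (R : realType) (n : nat) : enorm (0 : 'rV[R]_n) = 0.
Proof.
by rewrite /enorm big1 ?sqrtr0 // => i _; rewrite mxE expr0n.
Qed.

Lemma enorm_gt0 (R : realType) (n : nat) (u : 'rV[R]_n) :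
  (0 < enorm u) = (u != 0).
Proof.
have [->|u0] := eqVneq u 0; first by rewrite enorm0 ltxx.
rewrite lt_neqAle enorm_ge0 andbT eq_sym; apply: contra u0 => /eqP u0.
apply/eqP/rowP => i; rewrite mxE; apply/eqP; rewrite -sqrf_eq0; apply/eqP.
have /psumr_eq0P : \sum_(i < n) u 0 i ^+ 2 = 0.
  by rewrite -enorm_sqr u0 expr0n.
by apply => // j _; exact: sqr_ge0.
Qed.

Lemma enormD_sqr (R : realType) (n : nat) (u v : 'rV[R]_n) :
  enorm (u + v) ^+ 2 = enorm u ^+ 2 + 2 * edot u v + enorm v ^+ 2.
Proof.
rewrite !enorm_sqr /edot mulr_sumr -!big_split /=.
by apply: eq_bigr => i _; rewrite mxE; ring.
Qed.

Lemma edot_sumZ (R : realType) (n N : nat) (u : 'rV[R]_n) (c : 'I_N -> R)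
    (w : 'I_N -> 'rV[R]_n) :
  edot u (\sum_j c j *: w j) = \sum_j c j * edot u (w j).
Proof.
rewrite /edot; under [RHS]eq_bigr do rewrite mulr_sumr.
rewrite exchange_big /=; apply: eq_bigr => i _.
by rewrite summxE mulr_sumr; apply: eq_bigr => j _; rewrite mxE mulrCA.
Qed.

(** Minimality of [x p] makes the first order term of [|x p + w - z|^2]
comparable with second moments, and the square of the displacement [w] is
simply dropped; the step may therefore be arbitrarily large. *)
Lemma nearest_displacement (R : realType) (n N : nat) (z : 'rV[R]_n)
    (x : 'I_N -> 'rV[R]_n) (p : 'I_N) (c : 'I_N -> R) :
  (forall i, enorm (x p - z) <= enorm (x i - z)) ->
  (forall j, 0 <= c j) ->
  enorm (x p - z) ^+ 2 <=
    enorm (x p + \sum_j c j *: (x j - x p) - z) ^+ 2 +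
    \sum_j c j * enorm (x j - x p) ^+ 2.
Proof.
move=> xp c0; rewrite (addrAC (x p)) (enormD_sqr _ _ (x p - z)) edot_sumZ.
set w := (\sum_j _ *: _).
have dotge j : - enorm (x j - x p) ^+ 2 <= 2 * edot (x p - z) (x j - x p).
  have : enorm (x p - z) ^+ 2 <= enorm (x j - z) ^+ 2.
    by rewrite ler_sqr ?nnegrE ?enorm_ge0.
  have -> : x j - z = (x p - z) + (x j - x p) by rewrite [RHS]addrC subrKA.
  by rewrite (enormD_sqr _ _ (x p - z)); lra.
have : 0 <= 2 * (\sum_j c j * edot (x p - z) (x j - x p)) +
            \sum_j c j * enorm (x j - x p) ^+ 2.
  rewrite mulr_sumr -big_split /= sumr_ge0 // => j _.
  by have := c0 j; have := dotge j; nra.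
by have := sqr_ge0 (enorm w); lra.
Qed.

(** * Weights of the scheme *)

Section Weights.
Variables (R : realType) (n d N : nat) (rho xi : R -> R) (eps : R).
Variables (m : 'I_N -> R) (x : 'I_N -> 'rV[R]_n) (i : 'I_N).
Hypothesis hker : natural_kernel_pair n rho xi.
Hypotheses (eps0 : 0 < eps) (m0 : forall j, 0 < m j).
Hypothesis den0 : 0 < omega_den xi eps m x i.

Let den := omega_den xi eps m x i.

(** [- s * rho' s = n * xi s >= 0], and the factor [s > 0] divides out. *)
Lemma kernel_derive_le0 (s : R) : 0 < s -> derive1 rho s <= 0.
Proof.
move=> s0; have := rho_xi hker (ltW s0) => E.
have : 0 <= n%:R * xi s by rewrite mulr_ge0 // (xi_ge0 hker) // ltW.
by rewrite -E -mulrN (pmulr_rge0 _ s0) oppr_ge0.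
Qed.

Lemma omega_ge0 (j : 'I_N) : 0 <= omega d rho xi eps m x i j.
Proof.
rewrite /omega; case: eqVneq => // xji.
have r0 : 0 < enorm (x j - x i) by rewrite enorm_gt0 subr_eq0.
rewrite mulNr -mulrN -mulNr -mulNr -mulrN.
apply: mulr_ge0; first by apply: divr_ge0.
apply: divr_ge0; last exact: ltW den0.
apply: mulr_ge0; last by rewrite invr_ge0 ltW.
apply: mulr_ge0; first exact: ltW.
by rewrite oppr_ge0 kernel_derive_le0 // divr_gt0.
Qed.

(** Equality holds for distinct positions; coinciding points contribute only to
the right-hand side. *)
Lemma omega_second_moment_le (j : 'I_N) :
  omega d rho xi eps m x i j * enorm (x j - x i) ^+ 2 <=
    eps * d%:R * (m j * xi (enorm (x j - x i) / eps)) / den.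
Proof.
have rhs0 : 0 <= eps * d%:R * (m j * xi (enorm (x j - x i) / eps)) / den.
  rewrite divr_ge0 ?(ltW den0) // !mulr_ge0 ?(ltW eps0) ?(ltW (m0 j)) //.
  by rewrite (xi_ge0 hker) // divr_ge0 ?enorm_ge0 ?(ltW eps0).
rewrite /omega; case: eqVneq => [_|xji]; first by rewrite mul0r.
(* Distinct positions exist only in positive dimension. *)
have nR0 : n%:R != 0 :> R.
  apply: contra xji; rewrite pnatr_eq0 => /eqP n0.
  by apply/eqP/rowP => -[l ln]; exfalso; move: (ln); rewrite n0.
have r0 : 0 < enorm (x j - x i) by rewrite enorm_gt0 subr_eq0.
have := rho_xi hker (divr_ge0 (ltW r0) (ltW eps0)).
set r := enorm _ in r0 *; set D := derive1 _ _ => E.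
have -> : xi (r / eps) = - (r / eps * D) / n%:R.
  by rewrite E [n%:R * _]mulrC mulfK.
rewrite le_eqVlt; apply/orP; left; apply/eqP.
by rewrite /den; field; rewrite nR0 !gt_eqF.
Qed.

(** The weighted values of [xi] that bound the summands are exactly those that
the normalisation adds up, so their quotient is [1]. *)
Lemma omega_second_moment :
  \sum_j omega d rho xi eps m x i j * enorm (x j - x i) ^+ 2 <= eps * d%:R.
Proof.
apply: (le_trans (ler_sum _ (fun j _ => omega_second_moment_le j))).
rewrite -mulr_suml -mulr_sumr -mulrA.
by rewrite divff ?mulr1 // gt_eqF.
Qed.

End Weights.

(** * Nearest points under one step *)

Lemma scheme_mass_gt0 (R : realType) (n d N : nat) (mr : mass_rule)
    (V V' : point_cloud R n d N) (i : 'I_N) : 0 < scheme_mass mr V V' i.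
Proof. by case: mr; exact: mass_gt0. Qed.

(** The weights enter [nearest_displacement] as [2 * (tau / eps) * omega p j],
the factor [2] being the one of the projection choice [2 Id]; with second
moment at most [eps * d], the parameter [eps] cancels. *)
Lemma scheme_step_nearest (R : realType) (n d N : nat) (rho xi : R -> R)
    (eps tau : R) (mr : mass_rule) (V V' : point_cloud R n d N)
    (z : 'rV[R]_n) (p : 'I_N) :
  natural_kernel_pair n rho xi -> 0 < eps -> 0 < tau ->
  scheme_step rho xi eps tau mr V V' -> nearest V z p ->
  enorm (pos V p - z) ^+ 2 <= enorm (pos V' p - z) ^+ 2 + 2 * d%:R * tau.
Proof.
move=> hker eps0 tau0 step near; have [den0 ->] := step p.
set m := scheme_mass mr V V' in den0 *.
have m0 j : 0 < m j by exact: scheme_mass_gt0.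
pose w := omega d rho xi eps m (pos V) p.
pose c j := 2 * (tau / eps) * w j.
have te0 : 0 < 2 * (tau / eps) by rewrite mulr_gt0 ?divr_gt0.
have c0 j : 0 <= c j.
  by rewrite mulr_ge0 ?(ltW te0) //; exact: omega_ge0.
rewrite (_ : _ *: _ = \sum_j c j *: (pos V j - pos V p)); last first.
  rewrite scaler_sumr; apply: eq_bigr => j _.
  by rewrite !scalerA; congr (_ *: _); rewrite /c /w; ring.
apply: (le_trans (nearest_displacement _ _ _ _ _ _ _ near c0)).
rewrite lerD2l.
under eq_bigr do rewrite /c -mulrA.
rewrite -mulr_sumr.
have := omega_second_moment _ _ d _ _ _ _ _ _ _ hker eps0 m0 den0.
rewrite -(ler_pM2l te0) => /le_trans; apply.
rewrite le_eqVlt; apply/orP; left; apply/eqP; field.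
by rewrite gt_eqF.
Qed.

(** * Support of the mass measure *)

Section Support.
Variables (R : realType) (n d N : nat) (V : point_cloud R n d N).

Lemma mass_measureE (A : set 'rV[R]_n) :
  mass_measure V A = \sum_(i < N) mass V i * \1_A (pos V i).
Proof.
apply: eq_bigr => i _; congr (_ * _).
rewrite !indicE; congr (nat_of_bool _)%:R.
by apply/idP/idP; rewrite !inE; [case|split].
Qed.

Lemma pos_spt (i : 'I_N) : spt (mass_measure V) (pos V i).
Proof.
move=> r r0; rewrite mass_measureE (bigD1 i) //= ltr_pwDl //.
  by rewrite indicE mem_set ?mulr1 ?mass_gt0 // /eball /= subrr enorm0.
by rewrite sumr_ge0 // => j _; rewrite mulr_ge0 // ltW // mass_gt0.
Qed.

(** A point that is not a position has a ball around it, of radius its least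
distance to the finitely many positions, that carries no mass. *)
Lemma spt_pos (y : 'rV[R]_n) :
  spt (mass_measure V) y -> exists i, y = pos V i.
Proof.
move=> yV; apply: contrapT => /forallNP yx.
(* The default value 1 covers an empty cloud. *)
pose r := \big[Order.min/1]_(i < N) enorm (pos V i - y).
have r0 : 0 < r.
  apply/bigmin_gtP; split=> // i _; rewrite enorm_gt0 subr_eq0.
  by apply/eqP => /esym; exact: yx.
have := yV r r0; rewrite mass_measureE big1 ?ltxx // => i _.
rewrite indicE memNset ?mulr0 // /eball /=; apply/negP; rewrite -leNgt.
exact: bigmin_le_cond.
Qed.

End Support.

(** * Avoidance of balls *)

Theorem proposition3p5 (R : realType) (n d N : nat) (rho xi : R -> R)
  (eps tau : R) (mr : mass_rule)
  (V0 : point_cloud R n d N) (V : nat -> point_cloud R n d N) (k : nat)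
  (hker : natural_kernel_pair n rho xi)
  (heps0 : 0 < eps) (heps1 : eps < 1) (htau : 0 < tau)
  (hV0 : V 0%N = V0)
  (hV : forall l : nat, scheme_step rho xi eps tau mr (V l) (V l.+1)) :
  (forall (z : 'rV[R]_n) (p : 'I_N),
     nearest (V k) z p ->
     enorm (pos (V k) p - z) ^+ 2
       <= enorm (pos (V k.+1) p - z) ^+ 2 + 2 * d%:R * tau) /\
  (forall (a : 'rV[R]_n) (r : R),
     (exists p : 'I_N, nearest (V k) a p /\ nearest (V k.+1) a p) ->
     0 <= r -> 2 * d%:R * tau <= r ^+ 2 ->
     spt (mass_measure (V k)) `<=` ~` eball a r ->
     spt (mass_measure (V k.+1))
       `<=` ~` eball a (Num.sqrt (r ^+ 2 - 2 * d%:R * tau))).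
Proof.
have step z p := scheme_step_nearest _ _ _ _ _ _ _ _ _ _ _ z p
  hker heps0 htau (hV k).
split=> // a r [p [near near']] r0 rtau sptV y /spt_pos[i ->] yball.
have := sptV _ (pos_spt _ _ _ _ (V k) p); apply.
rewrite /eball /= -ltr_sqr ?nnegrE ?enorm_ge0 //.
apply: (le_lt_trans (step _ _ near)); rewrite -ltrBrDr.
have /lt_le_trans : enorm (pos (V k.+1) p - a) ^+ 2 <
    Num.sqrt (r ^+ 2 - 2 * d%:R * tau) ^+ 2.
  rewrite ltr_sqr ?nnegrE ?enorm_ge0 ?sqrtr_ge0 //.
  exact: le_lt_trans (near' i) yball.
by apply; rewrite sqr_sqrtr // subr_ge0.
Qed.
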